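(* Let $S$ be a topological cryptogroup. Then $S$ is a band of topological groups if and only if each $\mathcal{H}$-class is open in $S$.
   Context: A topological semigroup is a semigroup $S$ with a topology such that $(x,y)\mapsto xy$, $S\times S\to S$, is continuous. A semigroup $S$ is completely regular if for each $a\in S$ there is $x\in S$ with $a=axa$ and $ax=xa$. In such a semigroup Green's relations are: $a\,\mathcal{L}\,b$ iff $Sa=Sb$; $a\,\mathcal{R}\,b$ iff $aS=bS$; $\mathcal{H}=\mathcal{L}\cap\mathcal{R}$. A cryptogroup is a completely regular semigroup in which $\mathcal{H}$ is a congruence. In a cryptogroup, each $\mathcal{H}$-class $H_x$ is a group, $x^0$ is its identity, and $x^{-1}$ is the inverse of $x$ in the group $H_x$. A topological cryptogroup is a topological semigroup which is a cryptogroup and for which $x\mapsto x^{-1}$ is continuous. A band is a semigroup in which every element is idempotent; a band congruence on $S$ is a congruence $\rho$ with $S/\rho$ a band. A topological semigroup $(S,\tau)$ is a band $B$ of topological groups $(G_\alpha,\tau_\alpha)$ $(\alpha\in B)$ if $S$ admits a band congruence $\rho$ such that $S/\rho=B$, each $G_\alpha$ is a topological group (under the operation of $S$ and the topology $\tau_\alpha$) that is the $\rho$-class mapped onto $\alpha$ by the natural epimorphism $S\to B$, and $\bigcup_{\alpha\in B}\tau_\alpha$ is a base for $\tau$. ''Band of topological groups'' means a band $B$ of topological groups for some $B$ and some $(G_\alpha,\tau_\alpha)$. *)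

(* Defs.v *)
From HB Require Import structures.
From mathcomp Require Import all_boot.
From mathcomp Require Import all_classical topology.

Set Implicit Arguments.
Unset Strict Implicit.
Unset Printing Implicit Defensive.

Local Open Scope classical_set_scope.
Local Open Scope quotient_scope.
Local Open Scope group_scope.

HB.mixin Record isTopologicalSemigroup S of Semigroup S & Topological S := {
  mul_continuous : continuous (fun p : S * S => p.1 * p.2)
}.

#[short(type="topSemigroupType")]
HB.structure Definition TopologicalSemigroup :=
  {S of Semigroup S & Topological S & isTopologicalSemigroup S}.

Section Semigroups.
Variable S : semigroupType.
Implicit Types (a b x y e : S) (G : set S).

Definition completely_regular :=
  forall a, exists x, a = a * x * a /\ a * x = x * a.

(* Sa and aS are taken literally, without adjoining an identity to S. *)
Definition greenL a b := range (fun s => s * a) = range (fun s => s * b).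
Definition greenR a b := range (fun s => a * s) = range (fun s => b * s).
Definition greenH a b := greenL a b /\ greenR a b.

Definition Hclass a : set S := [set b | greenH a b].

Definition congruence (r : S -> S -> Prop) :=
  [/\ forall x, r x x,
      forall x y, r x y -> r y x,
      forall x y z, r x y -> r y z -> r x z &
      forall a b c d, r a b -> r c d -> r (a * c) (b * d)].

Definition cryptogroup := completely_regular /\ congruence greenH.

Definition band := forall x, x * x = x.

Definition identity_in G e := G e /\ forall x, G x -> e * x = x /\ x * e = x.

Definition inverse_in G x y :=
  [/\ G x, G y, identity_in G (x * y) & identity_in G (y * x)].

Definition is_group G :=
  [/\ forall x y, G x -> G y -> G (x * y),
      exists e, identity_in G e &
      forall x, G x -> exists y, inverse_in G x y].

(* Inverses are unique when they exist; x is returned when there is none. *)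
Definition inv_in G x : S := xget x [set y | inverse_in G x y].

(* x^-1, the inverse of x in its H-class. *)
Definition cinv x : S := inv_in (Hclass x) x.

Definition topology_on G (tau : set (set S)) :=
  [/\ forall U, tau U -> U `<=` G,
      tau set0,
      tau G,
      forall U V, tau U -> tau V -> tau (U `&` V) &
      forall F : set (set S), F `<=` tau -> tau (\bigcup_(U in F) U)].

Definition is_topological_group G (tau : set (set S)) :=
  [/\ is_group G,
      topology_on G tau,
      forall x y U, G x -> G y -> tau U -> U (x * y) ->
        exists V W, [/\ tau V, tau W, V x, W y &
          forall v w, V v -> W w -> U (v * w)] &
      forall U, tau U -> tau (G `&` inv_in G @^-1` U)].

End Semigroups.

Section QuotientSemigroup.
Variables (S : semigroupType) (r : S -> S -> Prop) (hr : congruence r).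

Definition cong_rel : rel S := fun x y => `[< r x y >].

Fact cong_refl : reflexive cong_rel.
Proof. by case: hr => h _ _ _ x; apply/asboolP. Qed.

Fact cong_sym : symmetric cong_rel.
Proof.
by case: hr => _ h _ _ x y; apply/asboolP/asboolP; apply: h.
Qed.

Fact cong_trans : transitive cong_rel.
Proof.
case: hr => _ _ h _ y x z /asboolP rxy /asboolP ryz.
by apply/asboolP; apply: h ryz.
Qed.

Definition cong_equiv : equiv_rel S :=
  EquivRel cong_rel cong_refl cong_sym cong_trans.

Definition quotient : Type := {eq_quot cong_equiv}.

HB.instance Definition _ : EqQuotient S cong_equiv quotient :=
  EqQuotient.on quotient.
HB.instance Definition _ := Choice.on quotient.

Definition quotient_mul (u v : quotient) : quotient :=
  \pi_quotient (repr u * repr v).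

Lemma quotient_pi_eq (x y : S) : \pi_quotient x = \pi_quotient y <-> r x y.
Proof.
split; first by move/eqmodP/asboolP.
by move=> rxy; apply/eqmodP/asboolP.
Qed.

Lemma quotient_mulE (x y : S) :
  quotient_mul (\pi_quotient x) (\pi_quotient y) = \pi_quotient (x * y).
Proof.
have [_ _ _ rM] := hr.
by apply/quotient_pi_eq; apply: rM; apply/quotient_pi_eq; rewrite reprK.
Qed.

Fact quotient_mulA : associative quotient_mul.
Proof.
elim/quotW=> x; elim/quotW=> y; elim/quotW=> z.
rewrite (quotient_mulE y z) (quotient_mulE x y).
by rewrite (quotient_mulE x (y * z)) (quotient_mulE (x * y) z) mulgA.
Qed.

HB.instance Definition _ := isSemigroup.Build quotient quotient_mulA.

End QuotientSemigroup.

(* "S / r = B" is read up to the semigroup isomorphism phi, so that the natural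
   epimorphism S -> B is x |-> phi (\pi x). *)
Definition is_band_of_topological_groups (S : topSemigroupType)
    (B : semigroupType) (G : B -> set S) (tau : B -> set (set S)) :=
  exists (r : S -> S -> Prop) (hr : congruence r)
    (phi : {multiplicative quotient hr -> B}),
    [/\ band (quotient hr),
        bijective phi,
        forall alpha, G alpha = [set x | phi (\pi_(quotient hr) x) = alpha],
        forall alpha, is_topological_group (G alpha) (tau alpha) &
        basis (\bigcup_(alpha in [set: B]) tau alpha)].

Definition band_of_topological_groups (S : topSemigroupType) :=
  exists (B : semigroupType) (G : B -> set S) (tau : B -> set (set S)),
    is_band_of_topological_groups G tau.

Definition topological_cryptogroup (S : topSemigroupType) :=
  cryptogroup S /\ continuous (@cinv S).

(* Main.v *)
Require Import Defs.
From mathcomp Require Import all_boot.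
From mathcomp Require Import all_classical topology.

(** The H-relation contains every congruence whose classes are groups: inside
    a group any two elements divide each other on both sides
    ([greenH_group]). Hence, if [S] is a band of topological groups with
    congruence [r], each H-class is the union of the r-classes of its points.
    Each r-class [G alpha] is the whole space of [tau alpha], so it is a basic
    open set, and H-classes are open.

    Conversely, H is itself a band congruence of a cryptogroup, since every
    element is H-related to its square, and its classes are groups
    ([Hclass_is_group]). When these classes are open, giving each one the
    subspace topology amounts to keeping the open sets of [S] that it contains;
    these sets form a base, and multiplication and inversion on a class are
    continuous as restrictions of the continuous operations of [S]. *)

Set Implicit Arguments.
Unset Strict Implicit.
Unset Printing Implicit Defensive.

Local Open Scope classical_set_scope.
Local Open Scope quotient_scope.
Local Open Scope group_scope.

Section GreenRelations.
Variable S : semigroupType.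
Implicit Types (a b e x y : S) (G : set S).

Lemma greenH_sym x y : greenH x y -> greenH y x.
Proof. by case=> L R; split; symmetry. Qed.

Lemma greenH_trans y x z : greenH x y -> greenH y z -> greenH x z.
Proof. by move=> [L R] [L' R']; split; [exact: etrans L L'|exact: etrans R R']. Qed.

Lemma greenH_Hclass x y : greenH x y -> Hclass x = Hclass y.
Proof.
move=> xy; apply/seteqP; split=> z /=; first exact/greenH_trans/greenH_sym.
exact: greenH_trans.
Qed.

(** Mutual divisibility is stronger than mutual generation of the literal
    ideals [Sa] and [aS]; it suffices below because its witnesses are always
    at hand. *)
Lemma greenH_divides x y u v u' v' :
  x = u * y -> y = v * x -> x = y * u' -> y = x * v' -> greenH x y.
Proof.
move=> xl yl xr yr; split; apply/seteqP; split=> _ [s _ <-] /=.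
- by exists (s * u) => //; rewrite -mulgA -xl.
- by exists (s * v) => //; rewrite -mulgA -yl.
- by exists (u' * s) => //; rewrite mulgA -xr.
- by exists (v' * s) => //; rewrite mulgA -yr.
Qed.

Lemma greenH_group G x y : is_group G -> G x -> G y -> greenH x y.
Proof.
move=> [_ _ invG] Gx Gy.
have [x' [_ _ [_ xx'1] [_ x'x1]]] := invG x Gx.
have [y' [_ _ [_ yy'1] [_ y'y1]]] := invG y Gy.
apply: (@greenH_divides _ _ (x * y') (y * x') (y' * x) (x' * y)).
- by rewrite -mulgA (y'y1 _ Gx).2.
- by rewrite -mulgA (x'x1 _ Gy).2.
- by rewrite mulgA (yy'1 _ Gx).1.
- by rewrite mulgA (xx'1 _ Gy).1.
Qed.

Lemma greenH_idem_unit e b : completely_regular S -> e * e = e ->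
  greenH e b -> e * b = b /\ b * e = b.
Proof.
move=> cr ee [Leb Reb]; have [x [b_reg _]] := cr b.
have [s _ bL] : range (fun s => s * e) b.
  by rewrite Leb; exists (b * x).
have [t _ bR] : range (fun t => e * t) b.
  by rewrite Reb; exists (x * b) => //; rewrite mulgA.
by split; [rewrite -bR mulgA ee|rewrite -bL -mulgA ee].
Qed.

(** The idempotent [a * x] is the identity of the H-class of [a]. *)
Lemma greenH_idem a x : a = a * x * a -> a * x = x * a ->
  greenH a (a * x) /\ a * x * (a * x) = a * x.
Proof.
move=> axa ax_xa; split; last by rewrite mulgA -axa.
apply: (@greenH_divides _ _ a x a x) => //.
by rewrite ax_xa mulgA.
Qed.

(** Multiply [a H a] by [a H a * x], where [a * x] fixes [a]. This makes the
    quotient by H a band. *)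
Lemma greenH_sqr a : completely_regular S -> congruence (@greenH S) ->
  greenH (a * a) a.
Proof.
move=> cr [refl _ _ compat]; have [x [axa ax_xa]] := cr a.
have [He _] := greenH_idem axa ax_xa.
by have := compat _ _ _ _ (refl a) He; rewrite ax_xa mulgA -axa.
Qed.

Lemma Hclass_is_group x : cryptogroup S -> is_group (Hclass x).
Proof.
move=> [cr cgr]; have [refl _ _ compat] := cgr.
have [w [xwx xw_wx]] := cr x.
have [He ee] := greenH_idem xwx xw_wx.
rewrite (greenH_Hclass He); set e := x * w in ee *.
have e_id : identity_in (Hclass e) e.
  by split=> [|y]; [exact: refl|exact: greenH_idem_unit].
split; [|by exists e|] => y.
  by move=> z ey ez; have := compat _ _ _ _ ey ez; rewrite ee.
move=> ey; have [b [yby yb_by]] := cr y.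
have [yf ff] := greenH_idem yby yb_by.
have ef := greenH_trans ey yf.
(* Two H-related idempotents coincide, each being an identity for the other. *)
have yb : y * b = e.
  rewrite -[LHS](greenH_idem_unit cr ee ef).1.
  exact: (greenH_idem_unit cr ff (greenH_sym ef)).2.
have by_ : b * y = e by rewrite -yb_by.
have [ey1 ye1] := e_id.2 _ ey.
(* [b] may lie outside the H-class; [b * y * b] is its projection into it. *)
have yb' : y * (b * y * b) = e by rewrite !mulgA yb -mulgA yb ee.
have b'y : b * y * b * y = e by rewrite -mulgA by_ ee.
exists (b * y * b); split=> //.
- apply: (greenH_trans ey).
  apply: (@greenH_divides _ _ (y * y) (b * b) (y * y) (b * b)).
  + by rewrite -mulgA yb' ye1.
  + by rewrite -!mulgA yb_by.
  + by rewrite mulgA b'y ey1.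
  + by rewrite -yb_by mulgA.
- by rewrite yb'.
- by rewrite b'y.
Qed.

End GreenRelations.

Section OpenHclasses.
Variable S : topSemigroupType.
Hypothesis hS : topological_cryptogroup S.
Hypothesis H_open : forall x : S, open (Hclass x).

Definition Hclass_topology (G : set S) : set (set S) :=
  [set U | open U /\ U `<=` G].

Lemma Hclass_topological_group x :
  is_topological_group (Hclass x) (Hclass_topology (Hclass x)).
Proof.
have [crypt cinv_cont] := hS; split.
- exact: Hclass_is_group.
- split=> [U []|||U V [oU UG] [oV _]|F FG] //.
  + by split=> [|y []]; exact: open0.
  + by split=> //; exact: H_open.
  + by split=> //; [exact: openI|move=> y [/UG]].
  + split=> [|y [U /FG[_ UG]]]; last exact: UG.
    by apply: bigcup_open => U /FG[].
- move=> y z U Gy Gz [oU _] Uyz.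
  have /= [[P Q] [/= nP nQ] PQ] :=
    @mul_continuous S (y, z) U (open_nbhs_nbhs (conj oU Uyz)).
  have oG := H_open x.
  exists (P° `&` Hclass x), (Q° `&` Hclass x).
  split; [split| split| by split | by split |] => //.
  + by apply: openI => //; exact: open_interior.
  + by apply: openI => //; exact: open_interior.
  + move=> v w [/interior_subset Pv _] [/interior_subset Qw _].
    exact: (PQ (v, w)).
- move=> U [oU _]; split; last by move=> y [].
  suff -> : Hclass x `&` inv_in (Hclass x) @^-1` U
          = Hclass x `&` @cinv S @^-1` U.
    by apply: openI => //; move/continuousP: cinv_cont; apply.
  by apply/seteqP; split=> y [Gy]; rewrite /= /cinv (greenH_Hclass Gy).
Qed.

Lemma open_Hclass_band : band_of_topological_groups S.
Proof.
have [[cr cgr] _] := hS.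
pose G (u : quotient cgr) := [set x : S | \pi_(quotient cgr) x = u].
have GE x : G (\pi_(quotient cgr) x) = Hclass x.
  apply/seteqP; split=> y /=.
    by move/quotient_pi_eq/greenH_sym.
  by move=> xy; apply/quotient_pi_eq/greenH_sym.
exists (quotient cgr), G, (fun u => Hclass_topology (G u)), (@greenH S), cgr.
exists idfun; split=> //.
- elim/quotW=> x; rewrite [LHS]quotient_mulE.
  by apply/quotient_pi_eq; exact: greenH_sqr.
- by elim/quotW=> x; rewrite GE; exact: Hclass_topological_group.
- split=> [U [u _ []] //|x U].
  rewrite nbhsE => -[V [oV Vx] VU].
  exists (V `&` Hclass x); last by move=> y [/VU].
  split; last by split.
  exists (\pi_(quotient cgr) x) => //; rewrite GE.
  by split; [exact: openI|move=> y []].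
Qed.

End OpenHclasses.

Lemma band_open_Hclass (S : topSemigroupType) (x : S) :
  band_of_topological_groups S -> open (Hclass x).
Proof.
move=> [B [G [tau [r [hr [phi [_ _ GE Ggrp [tau_open _]]]]]]]].
rewrite openE => y xy.
pose alpha := phi (\pi_(quotient hr) y).
have [grp [_ _ tauG _ _] _ _] := Ggrp alpha.
have Gy : G alpha y by rewrite GE.
have GH : G alpha `<=` Hclass x.
  by move=> z Gz; apply: greenH_trans xy _; exact: greenH_group Gz.
apply: filterS GH _; apply: open_nbhs_nbhs; split=> //.
by apply: tau_open; exists alpha.
Qed.

Theorem corollary2p7 (S : topSemigroupType) (hS : topological_cryptogroup S) :
  band_of_topological_groups S <-> forall x : S, open (Hclass x).
Proof.
split=> [hB x|]; first exact: band_open_Hclass.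
exact: open_Hclass_band.
Qed.
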